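(* Suppose $\mathsf{S}$ is a one-query $m$-coin $(\epsilon',\delta')$-steward for $k$ adaptively chosen $(\epsilon,\delta)$-concentrated functions $f_1,\dots,f_k:\{0,1\}^n\to\mathbb{R}^d$. Assume $\delta'<0.2$ and $\delta\ge 2^{-n}$. Then $m\ge n + \Omega(k) - \log_2(\delta'/\delta)$, where the $\Omega(\cdot)$ constant is absolute.
   Context: A function $f: \{0,1\}^n \to \mathbb{R}^d$ is $(\epsilon,\delta)$-concentrated at $\mu \in \mathbb{R}^d$ if $\Pr_{X}[\|f(X) - \mu\|_\infty > \epsilon] \le \delta$ for uniform $X\in\{0,1\}^n$. An $(\epsilon', \delta')$-steward for $k$ adaptively chosen $(\epsilon,\delta)$-concentrated functions is a randomized algorithm $\mathsf{S}$ interacting with an arbitrary (possibly randomized) owner $\mathsf{O}$: for $i = 1,\dots,k$, $\mathsf{O}$ adaptively chooses $f_i$ that is $(\epsilon,\delta)$-concentrated at some $\mu_i\in\mathbb{R}^d$ and gives it to $\mathsf{S}$, which returns $Y_i \in \mathbb{R}^d$; for every $\mathsf{O}$, $\Pr[\max_i \|Y_i - \mu_i\|_\infty > \epsilon'] \le \delta'$ (probability over the randomness of both). One-query: $\mathsf{S}$ accesses each $f_i$ only by evaluating it at a single point $X_i$ (not seen by the owner). $m$-coin: $\mathsf{S}$ uses $m$ uniformly random bits. *)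

(* Defs.v *)
From HB Require Import structures.
From mathcomp Require Import all_boot all_order all_algebra.
From mathcomp Require Import all_classical all_reals all_analysis.
Import Order.TTheory GRing.Theory Num.Theory.
Import numFieldNormedType.Exports.

Set Implicit Arguments.
Unset Strict Implicit.
Unset Printing Implicit Defensive.

Local Open Scope ring_scope.
Local Open Scope classical_set_scope.

Definition cube_fun (R : realType) (n d : nat) : Type :=
  n.-tuple bool -> 'rV[R]_d.

(* On ['rV[R]_d] the norm [`|x|] is the maximum norm ([mx_normrE]). *)
Definition concentrated (R : realType) (n d : nat) (eps delta : R)
    (f : cube_fun R n d) (mu : 'rV[R]_d) : Prop :=
  #|[pred x | eps < `|f x - mu|]|%:R / (2 ^ n)%:R <= delta.

(* Every list below is in chronological order.  The arguments are the [m] coins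
   and the nonempty list [f_1; ...; f_i] received so far; the value is [Y_i].
   The earlier answers of the steward are determined by these arguments. *)
Definition steward_alg (R : realType) (n d m : nat) : Type :=
  m.-tuple bool -> seq (cube_fun R n d) -> 'rV[R]_d.

(* [q ws] is the point at which the next function is queried when the earlier
   queries were answered by [ws]; the result is
   [f_1 X_1; ...; f_i X_i] for [fs = [f_1; ...; f_i]]. *)
Definition query_answers (R : realType) (n d : nat)
    (q : seq 'rV[R]_d -> n.-tuple bool) (fs : seq (cube_fun R n d)) :
    seq 'rV[R]_d :=
  foldl (fun ws (f : cube_fun R n d) => rcons ws (f (q ws))) [::] fs.

Definition one_query (R : realType) (n d m : nat) (S : steward_alg R n d m) :
    Prop :=
  exists (query : m.-tuple bool -> seq 'rV[R]_d -> n.-tuple bool)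
         (answer : m.-tuple bool -> seq 'rV[R]_d -> 'rV[R]_d),
  forall (c : m.-tuple bool) (fs : seq (cube_fun R n d)),
    S c fs = answer c (query_answers (query c) fs).

(* An owner whose random choices have been fixed: it maps the steward's answers
   [Y_1; ...; Y_(i-1)] to the pair [(f_i, mu_i)]. *)
Definition owner (R : realType) (n d : nat) : Type :=
  seq 'rV[R]_d -> cube_fun R n d * 'rV[R]_d.

Record round (R : realType) (n d : nat) : Type := Round {
  round_fun : cube_fun R n d;
  round_mu : 'rV[R]_d;
  round_ans : 'rV[R]_d
}.

Definition next_round (R : realType) (n d m : nat) (S : steward_alg R n d m)
    (c : m.-tuple bool) (O : owner R n d) (rs : seq (round R n d)) :
    round R n d :=
  let: (f, mu) := O (map (@round_ans R n d) rs) in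
  Round f mu (S c (rcons (map (@round_fun R n d) rs) f)).

Definition play (R : realType) (n d m : nat) (S : steward_alg R n d m)
    (c : m.-tuple bool) (O : owner R n d) (k : nat) : seq (round R n d) :=
  iter k (fun rs => rcons rs (next_round S c O rs)) [::].

Definition fails (R : realType) (n d m : nat) (S : steward_alg R n d m)
    (k : nat) (eps' : R) (c : m.-tuple bool) (O : owner R n d) : bool :=
  has (fun r => eps' < `|round_ans r - round_mu r|) (play S c O k).

(* The owner's random choices form an arbitrary probability space, independent
   of the uniform coins [c].  The measurability requirement only says that the
   failure event has a probability. *)
Definition is_steward (R : realType) (n d m : nat) (S : steward_alg R n d m)
    (k : nat) (eps delta eps' delta' : R) : Prop :=
  forall (disp : measure_display) (T : measurableType disp)
         (P : probability T R) (O : T -> owner R n d),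
    (forall t ys, concentrated eps delta (O t ys).1 (O t ys).2) ->
    (forall c, measurable [set t | fails S k eps' c (O t)]) ->
    (((2 ^ m)%:R^-1)%:E *
       \sum_(c : m.-tuple bool) P [set t | fails S k eps' c (O t)]
     <= delta'%:E)%E.

(* One-sided, unlike [=Omega_] in [landau], which compares absolute values and
   would allow [g] to tend to minus infinity. *)
Definition big_Omega (R : realType) (g h : nat -> R) : Prop :=
  exists (c : R) (k0 : nat),
    0 < c /\ forall k : nat, (k0 <= k)%N -> c * h k <= g k.

(* [ln] is [0] at nonpositive arguments. *)
Definition log2 (R : realType) (x : R) : R := ln x / ln 2.

(* Main.v *)
(* The owner keeps the set [C] of coins consistent with what it has seen and
   moves slowly from the constant function 0 to a constant far above [eps'],
   changing one point by [eps] at a time.  Unless it can make a quarter of [C]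
   fail at once (at one of the ends, or because half of [C] queries the same
   point), some function on the way has the property that the event
   [eps' < `|Y|] splits [C] into two parts, each of size at least [#|C| / 4].
   After many rounds the coins are spread over exponentially many branches, and
   in the last round a bad set of about [delta * 2 ^ n] points is chosen in each
   branch separately.  So an owner makes at least
   [min (2^m / 4, (4/3)^(k-1) * delta * 2^n / 4)] coins fail. *)
Require Import Defs.
From HB Require Import structures.
From mathcomp Require Import all_boot all_order all_algebra.
From mathcomp Require Import all_classical all_reals all_analysis.
From mathcomp Require Import zify ring lra.
Import Order.TTheory GRing.Theory Num.Theory.
Import numFieldNormedType.Exports.
Local Open Scope ring_scope.

Set Implicit Arguments.
Unset Strict Implicit.
Unset Printing Implicit Defensive.

(* [fails] read forwards: [fs] are the functions handed over so far, and the
   owner [O] receives only the answers given from now on. *)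
Fixpoint fails_after (R : realType) (n d m : nat) (S : steward_alg R n d m)
    (eps' : R) (c : m.-tuple bool) (fs : seq (cube_fun R n d))
    (O : owner R n d) (i : nat) : bool :=
  if i is j.+1 then
    let y := S c (rcons fs (O [::]).1) in
    (eps' < `|y - (O [::]).2|) ||
    fails_after S eps' c (rcons fs (O [::]).1) (fun ys => O (y :: ys)) j
  else false.

(** [play] appends rounds at the end while [fails_after] takes off the first one, so the induction
    runs over an arbitrary prefix [rs]. *)
Lemma has_iter_next_round (R : realType) (n d m : nat)
    (S : steward_alg R n d m) (eps' : R) (c : m.-tuple bool)
    (O : owner R n d) (i : nat) (rs : seq (round R n d)) :
  let bad r := eps' < `|round_ans r - round_mu r| in
  has bad (iter i (fun rs => rcons rs (next_round S c O rs)) rs) =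
  has bad rs ||
  fails_after S eps' c (map (@round_fun R n d) rs)
    (fun ys => O (map (@round_ans R n d) rs ++ ys)) i.
Proof.
move=> bad; elim: i rs => [|i IH] rs; first by rewrite orbF.
rewrite iterSr IH has_rcons !map_rcons /= cats0 /next_round.
case: (O _) => f mu /=; rewrite orbA [_ || has _ _]orbC; congr (_ || _).
by congr fails_after; apply/funext => ys; rewrite cat_rcons.
Qed.

Lemma failsE (R : realType) (n d m : nat) (S : steward_alg R n d m) (k : nat)
    (eps' : R) (c : m.-tuple bool) (O : owner R n d) :
  fails S k eps' c O = fails_after S eps' c [::] O k.
Proof. exact: (has_iter_next_round S eps' c O k [::]). Qed.

(** * What an owner can achieve in a single round *)

Lemma exists_unit_row (R : realType) (d : nat) :
  (0 < d)%N -> exists u : 'rV[R]_d, `|u| = 1.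
Proof.
case: d => // d _.
have u0 : (const_mx 1 : 'rV[R]_d.+1) != 0.
  apply/eqP => /matrixP /(_ 0 0); rewrite !mxE => /eqP.
  by rewrite oner_eq0.
exists (`|const_mx 1 : 'rV[R]_d.+1|^-1 *: const_mx 1).
by rewrite normrZ normfV normr_id mulVf // normr_eq0.
Qed.

Lemma concentrated_card (R : realType) (n d : nat) (eps delta : R) (B : nat)
    (f : cube_fun R n d) (mu : 'rV[R]_d) :
  B%:R / (2 ^ n)%:R <= delta ->
  (#|[pred x | (eps < `|f x - mu|)%R]| <= B)%N -> concentrated eps delta f mu.
Proof.
move=> Bd le_B; apply: le_trans Bd.
by rewrite ler_wpM2r ?invr_ge0 ?ler0n // ler_nat.
Qed.

Lemma concentrated_close (R : realType) (n d : nat) (eps delta : R)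
    (f : cube_fun R n d) (mu : 'rV[R]_d) :
  0 <= delta -> (forall x, `|f x - mu| <= eps) -> concentrated eps delta f mu.
Proof.
move=> d0 fmu; apply: (@concentrated_card _ _ _ _ _ 0); first by rewrite mul0r.
by rewrite leqn0; apply/eqP/eq_card0 => x; rewrite inE ltNge fmu.
Qed.

Lemma norm_far (R : realDomainType) (V : normedZmodType R) (e : R) (y v : V) :
  2 * `|e| < `|v| -> `|y| <= e -> e < `|y - v|.
Proof.
move=> lt_v le_y; have := ler_normB y (y - v); rewrite subKr.
by have := ler_norm e; lra.
Qed.

(* On [D] the two functions [f] and the constant [w *: u] look the same, but
   no answer is good for both, since their means are more than [2 eps'] apart. *)
Lemma fool_bad_set (R : realType) (n d : nat) (eps delta eps' : R) (B : nat)
    (u : 'rV[R]_d) (I : finType) (X : I -> n.-tuple bool)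
    (H : I -> 'rV[R]_d -> 'rV[R]_d) (D : {set I}) :
  `|u| = 1 -> 0 <= eps -> B%:R / (2 ^ n)%:R <= delta -> (#|X @: D| <= B)%N ->
  exists (f : cube_fun R n d) (mu : 'rV[R]_d), concentrated eps delta f mu /\
    (#|D| <= 2 * #|[set c in D | (eps' < `|H c (f (X c)) - mu|)%R]|)%N.
Proof.
move=> u1 e0 Bd cardD; pose w : R := 2 * `|eps'| + 1.
pose f : cube_fun R n d := fun x => if x \in X @: D then w *: u else 0.
have d0 : 0 <= delta by apply: le_trans Bd; rewrite divr_ge0 ?ler0n.
pose F1 := [set c in D | eps' < `|H c (f (X c)) - 0|].
pose F2 := [set c in D | eps' < `|H c (w *: u) - w *: u|].
have DF : (#|D| <= #|F1| + #|F2|)%N.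
  apply: leq_trans (leq_card_setU F1 F2).
  apply/subset_leq_card/fintype.subsetP => c cD.
  rewrite !inE cD /= /f imset_f // subr0 -implyNb -leNgt; apply/implyP.
  have w0 : 0 <= w by rewrite addr_ge0 ?mulr_ge0.
  by apply: norm_far; rewrite normrZ u1 mulr1 ger0_norm // ltrDl.
have [le12|lt21] := leqP #|F2| #|F1|.
  exists f, 0; split; last by rewrite -/F1; lia.
  apply: (concentrated_card Bd); apply: leq_trans cardD.
  apply/subset_leq_card/fintype.subsetP => x; rewrite inE /f.
  by case: ifP => // _; rewrite subrr normr0 ltNge e0.
exists (fun=> w *: u), (w *: u); split; last by rewrite -/F2; lia.
by apply: concentrated_close => // x; rewrite subrr normr0.
Qed.

Lemma split_or_fool (R : realType) (n d : nat) (eps delta eps' : R)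
    (u : 'rV[R]_d) (I : finType) (X : I -> n.-tuple bool)
    (H : I -> 'rV[R]_d -> 'rV[R]_d) (C : {set I}) :
  `|u| = 1 -> 0 < eps -> 1 / (2 ^ n)%:R <= delta ->
  exists (f : cube_fun R n d) (mu : 'rV[R]_d), concentrated eps delta f mu /\
    ((#|C| <= 4 * #|[set c in C | (eps' < `|H c (f (X c)) - mu|)%R]|)%N \/
     (#|C| <= 4 * #|C :&: [set c | (eps' < `|H c (f (X c))|)%R]|)%N /\
     (#|C| <= 4 * #|C :\: [set c | (eps' < `|H c (f (X c))|)%R]|)%N).
Proof.
move=> u1 e0 d1.
have d0 : 0 <= delta by apply: le_trans d1; rewrite divr_ge0 ?ler0n.
have [/existsP[x heavy]|/existsPn light] :=
  boolP [exists x, #|C| <= 2 * #|[set c in C | X c == x]|]%N.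
  set D := [set c in C | X c == x] in heavy.
  have cardD : (#|X @: D| <= 1)%N.
    rewrite -(cards1 x).
    apply/subset_leq_card/fintype.subsetP => _ /imsetP[c cD ->].
    by move: cD; rewrite !inE => /andP[].
  have [f [mu [fmu le_D]]] :=
    fool_bad_set eps' H u1 (ltW e0) (d1 : 1%:R / _ <= _) cardD.
  exists f, mu; split=> //; left; apply: leq_trans heavy _.
  rewrite -[4%N]/(2 * 2)%N -mulnA leq_mul2l; apply: leq_trans le_D _.
  rewrite leq_mul2l; apply/subset_leq_card/fintype.subsetP => c; rewrite !inE.
  by case/andP=> /andP[-> _] ->.
pose P := #|{: n.-tuple bool}|.
have P0 : (0 < P)%N by apply/card_gt0P; exists [tuple of nseq n true].
(* Each increment of [t] raises the value at exactly one point by [eps]. With [q = t %/ P], the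
   coefficients of [u] are [q * eps] or [(q + 1) * eps], so no point is exceptional for the mean
   [(q * eps) *: u]. *)
pose f t : cube_fun R n d :=
  fun x => (((t + enum_rank x) %/ P)%:R * eps) *: u.
pose A t := [set c | eps' < `|H c (f t (X c))|].
have fmu t : concentrated eps delta (f t) (((t %/ P)%:R * eps) *: u).
  apply: concentrated_close => // x.
  rewrite /f -scalerBl -mulrBl normrZ u1 mulr1 normrM (gtr0_norm e0).
  rewrite ler_piMl ?(ltW e0) // divnD // (divn_small (ltn_ord _)) addn0.
  by rewrite natrD addrAC subrr add0r normr_nat lern1 leq_b1.
have [fail0|pass0] := leqP #|C| (4 * #|C :&: A 0%N|).
  exists (f 0%N), 0; split.
    by have := fmu 0%N; rewrite div0n mul0r scale0r.
  left; apply: leq_trans fail0 _; rewrite leq_mul2l.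
  apply/subset_leq_card/fintype.subsetP => c.
  by rewrite !inE subr0.
(* At time [N * P] the function is a constant so far from 0 that every answer of norm at most [eps']
   fails. *)
pose N := Num.bound (2 * `|eps'| / eps).
have Neps : 2 * `|eps'| < N%:R * eps.
  rewrite -ltr_pdivrMr //; apply: archi_boundP.
  by rewrite divr_ge0 ?mulr_ge0 // ltW.
have fN x : f (N * P)%N x = (N%:R * eps) *: u.
  by rewrite /f divnMDl // divn_small ?addn0 // ltn_ord.
have [failN|passN] := leqP #|C| (4 * #|C :\: A (N * P)%N|).
  exists (f (N * P)%N), ((N%:R * eps) *: u); split.
    by have := fmu (N * P)%N; rewrite mulnK.
  left; apply: leq_trans failN _; rewrite leq_mul2l.
  apply/subset_leq_card/fintype.subsetP => c; rewrite !inE fN -leNgt.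
  case/andP=> le_eps' ->; apply: norm_far le_eps'.
  by rewrite normrZ u1 mulr1 ger0_norm // mulr_ge0 ?ler0n ?ltW.
(* Consecutive [f t] differ in a single point, so by lightness [#|C :&: A t|]
   cannot jump over the middle half of the range [0, #|C|]. *)
have step t : (2 * #|C :&: A t.+1| < 2 * #|C :&: A t| + #|C|)%N.
  pose J := [set c in C | f t.+1 (X c) != f t (X c)].
  have Jx : exists x, J \subset [set c in C | X c == x].
    have [->|[c0]] := set_0Vmem J.
      by exists [tuple of nseq n true]; rewrite finset.sub0set.
    (* A change at [x] forces [P] to divide [t + enum_rank x + 1]; ranks are below [P], so this
       determines [x]. *)
    have JP c : c \in J -> (P %| (t + enum_rank (X c)).+1)%N.
      rewrite inE => /andP[_]; apply: contraNT => nd.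
      by rewrite /f addSn divnS // (negbTE nd).
    move=> c0J; exists (X c0); apply/fintype.subsetP => c cJ.
    have cC : c \in C by move: cJ; rewrite inE => /andP[].
    rewrite inE cC /=; apply/eqP/enum_rank_inj/val_inj/eqP.
    have : (t.+1 + enum_rank (X c) == t.+1 + enum_rank (X c0) %[mod P])%N.
      by rewrite !addSn (eqP (JP _ cJ)) (eqP (JP _ c0J)).
    by rewrite eqn_modDl !modn_small.
  have [x Jx'] := Jx; have := light x; rewrite -ltnNge => lt_x.
  have := subset_leq_card Jx' => le_J.
  have : C :&: A t.+1 \subset (C :&: A t) :|: J.
    apply/fintype.subsetP => c; rewrite !inE => /andP[-> lt_e] /=.
    by case: eqP => [<-|]; rewrite ?lt_e ?orbT.
  move/subset_leq_card/leq_trans/(_ (leq_card_setU _ _)) => le1; lia.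
have ex_t : exists t, (#|C| <= 4 * #|C :&: A t|)%N.
  by exists (N * P)%N; have := cardsID (A (N * P)%N) C; lia.
(* At the first [t] where the event reaches a quarter of [C], the last step added less than half of
   [C], so three quarters are not exceeded. *)
case: (ex_minnP ex_t) => -[|t] ge_t min_t.
  by rewrite leqNgt pass0 in ge_t.
exists (f t.+1), (((t.+1 %/ P)%:R * eps) *: u); split=> //; right; split=> //.
have lt_t : (4 * #|C :&: A t| < #|C|)%N.
  by rewrite ltnNge; apply/negP => /min_t; rewrite ltnn.
by have := step t; have := cardsID (A t.+1) C; rewrite -/(A t.+1); lia.
Qed.

(** * The adaptive owner *)

(** Once the earlier functions are fixed, their values at the queried points, and hence the next
    query point, depend on the coins alone. *)
Lemma one_queryE (R : realType) (n d m : nat) (S : steward_alg R n d m)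
    (fs : seq (cube_fun R n d)) :
  one_query S ->
  exists (X : m.-tuple bool -> n.-tuple bool)
         (H : m.-tuple bool -> 'rV[R]_d -> 'rV[R]_d),
  forall c f, S c (rcons fs f) = H c (f (X c)).
Proof.
move=> [q [a Sqa]].
exists (fun c => q c (query_answers (q c) fs)).
exists (fun c w => a c (rcons (query_answers (q c) fs) w)) => c f.
by rewrite Sqa /query_answers foldl_rcons.
Qed.

Lemma subset_of_card (I : finType) (C : {set I}) (b : nat) :
  exists2 D : {set I}, D \subset C & #|D| = minn b #|C|.
Proof.
have le_min : (minn b #|C| <= #|C|)%N by rewrite geq_minr.
have [s [us sz sC]] := card_geqP le_min.
exists [set x in s]; first by apply/fintype.subsetP => x; rewrite inE => /sC.
by rewrite cardsE (card_uniqP us).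
Qed.

Lemma exists_owner (R : realType) (n d m : nat) (S : steward_alg R n d m)
    (eps delta eps' : R) (B : nat) (u : 'rV[R]_d) :
  one_query S -> `|u| = 1 -> 0 < eps -> (0 < B)%N ->
  B%:R / (2 ^ n)%:R <= delta ->
  forall (i : nat) (fs : seq (cube_fun R n d)) (C : {set m.-tuple bool}),
  exists2 O : owner R n d,
    forall ys, concentrated eps delta (O ys).1 (O ys).2 &
    Num.min (#|C|%:R / 4) (B%:R / 2 * (4 / 3) ^+ i) <=
      #|[set c in C | fails_after S eps' c fs O i.+1]|%:R :> R.
Proof.
move=> S1 u1 e0 B0 Bd; elim=> [|i IH] fs C;
  have [X [H SXH]] := one_queryE fs S1.
  (* In the last round, keeping only [minn B #|C|] coins leaves at most [B] queried points, so the
     bad set fits into the budget [delta]. *)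
  have [D sDC cardD] := subset_of_card C B.
  have le_XD : (#|X @: D| <= B)%N.
    by apply: leq_trans (leq_imset_card _ _) _; rewrite cardD geq_minl.
  have [f [mu [fmu le_D]]] := fool_bad_set eps' H u1 (ltW e0) Bd le_XD.
  exists (fun=> (f, mu)) => //=; rewrite expr0 mulr1.
  set F := [set c in D | _] in le_D; set G := [set c in C | _].
  have FG : (#|F| <= #|G|)%N.
    apply/subset_leq_card/fintype.subsetP => c; rewrite !inE SXH orbF.
    by case/andP=> /(fintype.subsetP sDC) ->.
  have : (minn B #|C| <= 2 * #|G|)%N.
    by rewrite -cardD (leq_trans le_D) // leq_mul2l FG.
  rewrite /minn; case: ifP => _; rewrite -(ler_nat R) natrM => le_G.
    by rewrite ge_min; apply/orP; right; lra.
  have := ler0n R #|C|; rewrite ge_min => C0; apply/orP; left; lra.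
have B1 : 1 / (2 ^ n)%:R <= delta.
  by apply: le_trans Bd; rewrite ler_wpM2r ?invr_ge0 ?ler0n // ler1n.
have [f [mu [fmu]]] := split_or_fool eps' X H C u1 e0 B1.
case=> [fail|[ge1 ge2]].
  exists (fun=> (f, mu)) => //; rewrite ge_min; apply/orP; left.
  set F := [set c in C | _] in fail; set G := [set c in C | _].
  have FG : (#|F| <= #|G|)%N.
    apply/subset_leq_card/fintype.subsetP => c; rewrite !inE /= SXH.
    by case/andP=> -> ->.
  rewrite ler_pdivrMr // -natrM ler_nat mulnC.
  by rewrite (leq_trans fail) // leq_mul2l FG.
pose A := [set c | eps' < `|H c (f (X c))|].
rewrite -/A in ge1 ge2.
have [Q1 good1 le1] := IH (rcons fs f) (C :&: A).
have [Q2 good2 le2] := IH (rcons fs f) (C :\: A).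
(* The test on [y] tells whether the coins lie in [A], so [Q1] and [Q2] face disjoint sets of coins
   and their failures add up. *)
pose O : owner R n d := fun ys =>
  if ys is y :: ys' then if eps' < `|y| then Q1 ys' else Q2 ys' else (f, mu).
exists O; first by case=> [|y ys] //=; case: ifP.
set F1 := [set c in C :&: A | _] in le1.
set F2 := [set c in C :\: A | _] in le2.
set G := [set c in C | _].
have F1G : F1 \subset G :&: A.
  apply/fintype.subsetP => c.
  rewrite inE => /andP[/finset.setIP[cC cA] fail].
  rewrite finset.in_setI cA inE cC andbT andTb.
  move: cA fail; rewrite inE; move: i.+1 => j cA fail /=.
  by rewrite SXH cA fail orbT.
have F2G : F2 \subset G :\: A.
  apply/fintype.subsetP => c.
  rewrite inE => /andP[/finset.setDP[cC cA] fail].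
  rewrite finset.in_setD cA inE cC !andTb.
  move: cA fail; rewrite inE; move: i.+1 => j /negbTE cA fail /=.
  by rewrite SXH cA fail orbT.
have := cardsID A G; have := cardsID A C => cardC cardG.
have := subset_leq_card F1G; have := subset_leq_card F2G => le_F2 le_F1.
have : (#|F1| + #|F2| <= #|G|)%N by rewrite -cardG leq_add.
rewrite -(ler_nat R) natrD => le_G.
move: ge1 ge2; rewrite -!(ler_nat R) !natrM => ge1 ge2.
move: cardC => /(congr1 (fun k => k%:R : R)); rewrite natrD => cardC.
rewrite exprS mulrCA.
have : 0 <= B%:R / 2 * (4 / 3) ^+ i :> R.
  by rewrite mulr_ge0 ?exprn_ge0 ?divr_ge0 ?ler0n.
move: le1 le2; move: (_ * (4 / 3) ^+ i) => b.
rewrite ge_min => + + b0; rewrite !ge_min.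
(* If both branches reach [b], the total is [2 * b]. If one reaches only a quarter of its part, that
   is at least [#|C| / 16 > #|G| / 4], so [#|G| >= b + #|G| / 4]: this is the source of [4 / 3]. Two
   quarters would contradict [lt_C]. *)
have [//|lt_C] := lerP (#|C|%:R / 4) #|G|%:R.
by move=> /orP[le1|le1] /orP[le2|le2] /=; lra.
Qed.

(** * From counting failing coins to the bound on [m] *)

(** A deterministic owner lives on the one-point space: each probability is 0 or 1, and their sum
    counts coins. *)
Lemma steward_card_fails (R : realType) (n d m : nat)
    (S : steward_alg R n d m) (k : nat) (eps delta eps' delta' : R)
    (O : owner R n d) :
  is_steward S k eps delta eps' delta' ->
  (forall ys, concentrated eps delta (O ys).1 (O ys).2) ->
  #|[set c | fails S k eps' c O]|%:R <= delta' * 2 ^+ m.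
Proof.
move=> stw good.
have := stw _ unit (\d_tt : probability unit R) (fun=> O) (fun=> good).
have -> : (\sum_(c : m.-tuple bool) (\d_tt : probability unit R)
    [set t | fails S k eps' c O]%classic)%E =
    (#|[set c | fails S k eps' c O]|%:R%:E)%E.
  rewrite -sum1_card natr_sum -sumEFin [RHS]big_mkcond /=.
  apply: eq_bigr => c _; rewrite inE diracE.
  case: (fails _ _ _ _ _); first by rewrite mem_set.
  by rewrite memNset.
rewrite -EFinM lee_fin natrX mulrC ler_pdivrMr ?exprn_gt0 //; apply => c.
exact: I.
Qed.

Theorem theorem7p5 (R : realType) :
  exists g : nat -> R, big_Omega g (fun k => k%:R) /\
  forall (n d k m : nat) (eps delta eps' delta' : R)
         (S : steward_alg R n d m),
    (0 < d)%N -> (0 < k)%N -> 0 < eps ->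
    one_query S -> is_steward S k eps delta eps' delta' ->
    delta' < 1 / 5 -> 2 ^- n <= delta ->
    n%:R + g k - log2 (delta' / delta) <= m%:R.
Proof.
have ln2 : 0 < ln 2 :> R by rewrite ln_gt0 // ltr1n.
have L0 : 0 < log2 (4 / 3 : R) by rewrite divr_gt0 // ln_gt0 //; lra.
(* Only the rounds before the last gain a factor [4 / 3]. The [- 2] is the logarithm of [1 / 4]: one
   half is lost in the last round, one in rounding [delta * 2 ^+ n] down to [B]. *)
exists (fun k => k.-1%:R * log2 (4 / 3) - 2); split.
  exists (log2 (4 / 3) / 2).
  exists (Num.bound (2 * (log2 (4 / 3) + 2) / log2 (4 / 3) : R)).+1.
  split=> [|[//|k]]; first by rewrite divr_gt0.
  rewrite ltnS -(ler_nat R) => /(lt_le_trans (archi_boundP _)).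
  rewrite divr_ge0 ?(ltW L0) // => [/(_ isT)|]; last first.
    by rewrite mulr_ge0 // addr_ge0 // ltW.
  rewrite ltr_pdivrMr //= -[k.+1]addn1 natrD; nra.
move=> n d [//|k] m eps delta eps' delta' S d0 _ e0 S1 stw d'5 dn /=.
have [u u1] := exists_unit_row R d0.
have n2 : 0 < 2 ^+ n :> R by rewrite exprn_gt0.
have m2 : 0 < 2 ^+ m :> R by rewrite exprn_gt0.
have dn1 : 1 <= delta * 2 ^+ n by rewrite -ler_pdivrMr // div1r.
have delta0 : 0 < delta by rewrite -(pmulr_lgt0 _ n2); lra.
pose B := Num.truncn (delta * 2 ^+ n).
have /andP[le_B lt_B] : B%:R <= delta * 2 ^+ n < B.+1%:R.
  by apply: truncn_itv; lra.
have B0 : (0 < B)%N by rewrite /B truncn_gt0.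
have Bd : B%:R / (2 ^ n)%:R <= delta by rewrite natrX ler_pdivrMr.
have [Q good] := exists_owner eps' S1 u1 e0 B0 Bd k [::] [set: _].
have := steward_card_fails stw good.
set F := [set c | fails _ _ _ _ _]; set G := [set c in _ | _].
have -> : G = F by apply/setP => c; rewrite !inE failsE.
rewrite cardsT card_tuple card_bool natrX => le_F.
(* A quarter of all coins failing contradicts [delta' < 1 / 5]. *)
rewrite ge_min => /orP[|ge_F]; first by nra.
have B2 : delta * 2 ^+ n <= 2 * B%:R.
  have B1 : 1 <= B%:R :> R by rewrite ler1n.
  by move: lt_B; rewrite -addn1 natrD; lra.
have r0 : 0 < (4 / 3) ^+ k :> R by rewrite exprn_gt0 // divr_gt0.
have key : 2 ^+ n * (4 / 3) ^+ k / 4 <= delta' / delta * 2 ^+ m.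
  rewrite [leRHS]mulrAC ler_pdivlMr //; apply: le_trans (le_trans ge_F le_F).
  by have := ler_wpM2r (ltW r0) B2; lra.
(* Positivity of [delta'] comes out of [key]; it keeps [ln] away from its default value. *)
have q0 : 0 < delta' / delta.
  rewrite -(pmulr_lgt0 _ m2); apply: lt_le_trans key.
  by rewrite divr_gt0 // mulr_gt0.
move: (delta' / delta) q0 key => q q0 key.
have : ln (2 ^+ n * (4 / 3) ^+ k / 4) <= ln (q * 2 ^+ m).
  by rewrite ler_ln ?posrE ?divr_gt0 ?mulr_gt0.
have ln4 : ln 4 = ln 2 *+ 2 :> R by rewrite -lnXn // expr2; congr ln; lra.
have lnr : ln ((4 / 3) ^+ k) = ln (4 / 3) *+ k :> R by rewrite lnXn // divr_gt0.
rewrite ln_div ?posrE ?mulr_gt0 // !lnM ?posrE // ln4 lnr !lnXn //.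
rewrite -[ln 2 *+ n]mulr_natl -[ln _ *+ k]mulr_natl -[ln 2 *+ m]mulr_natl.
move=> le_ln.
rewrite -(ler_pM2r ln2) /log2.
have -> : (n%:R + (k%:R * (ln (4 / 3) / ln 2) - 2) - ln q / ln 2) * ln 2 =
  n%:R * ln 2 + k%:R * ln (4 / 3) - 2 * ln 2 - ln q :> R.
  by field; rewrite gt_eqF.
lra.
Qed.
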